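(* Let $P(z,\overline{z}) = \sum_{k=0}^m p_k(z)\,\overline{z}^k$ be a polyanalytic polynomial with $\deg p_k \leq n$ for each $k = 0,1,\dots,m$. Assume that $P(z,\overline{z})$ and $Q(z,\overline{z}) = \overline{P(z,\overline{z})}$ are coprime. Then the valence of $P$ is at most $n^2 + m^2$.
   Context: Here the $p_k$ are complex-analytic polynomials in $z$ (polynomials with complex coefficients). The valence of $P$ is the number of preimages of a prescribed point $w \in \mathbb{C}$, i.e., the number of points $z \in \mathbb{C}$ with $P(z,\overline{z}) = w$. Coprimality refers to $P$ and $Q$ viewed as bivariate polynomials in $z,\overline{z}$, i.e., treating $z$ and $\overline{z}$ formally as two independent variables $z_1=z$, $z_2=\overline{z}$: if $P(z_1,z_2)=\sum_{i,j} c_{i,j} z_1^i z_2^j$, then $Q(z_1,z_2) = \sum_{i,j} \overline{c_{i,j}}\, z_2^i z_1^j$. Two polynomials $P,Q\in\mathbb{C}[z_1,z_2]$ are coprime if their greatest common factor has degree zero, i.e., whenever $P = C P_1$ and $Q = C Q_1$ with $C,P_1,Q_1 \in \mathbb{C}[z_1,z_2]$, then $\deg C = 0$.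
   Formalization: For valence at a prescribed w, coprimality is required of P − w and its conjugate, not of P and Q (same when w = 0); as stated the claim fails: P = z z̄ + i and Q = z z̄ − i are coprime, but P = 1 + i on the whole unit circle. *)

(* Defs.v *)
From HB Require Import structures.
From mathcomp Require Import all_boot all_order all_algebra.
From mathcomp Require Import complex.
From mathcomp Require Import boolp classical_sets functions cardinality reals.

Set Implicit Arguments.
Unset Strict Implicit.
Unset Printing Implicit Defensive.

Import Order.TTheory GRing.Theory Num.Theory.

Local Open Scope ring_scope.

Section Polyanalytic.
Variable R : realType.
Local Notation C := R[i].

(* A polynomial of C[z1, z2] is an element of {poly {poly C}}: the inner
   variable is z1 = z and the outer one is z2 = conj z, so that the
   coefficient of z1^i z2^k in P is P`_k`_i. *)

(* p_0(z1) + p_1(z1) z2 + ... + p_m(z1) z2^m; the p k with k > m are unused. *)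
Definition polyanalytic (m : nat) (p : nat -> {poly C}) : {poly {poly C}} :=
  \sum_(k < m.+1) (p k)%:P * 'X^k.

Definition ev2 (P : {poly {poly C}}) (z1 z2 : C) : C := P.[z2%:P].[z1].

(* Q with Q(z, conj z) = conj (P(z, conj z)): conjugate the coefficients and
   exchange the two variables. *)
Definition conj_swap (P : {poly {poly C}}) : {poly {poly C}} :=
  swapXY (map_poly (map_poly Num.conj) P).

(* A common factor of degree zero is a nonzero constant.  The library's
   coprimep is not suitable: its gcd only controls the degree in the outer
   variable. *)
Definition coprime2 (P Q : {poly {poly C}}) : Prop :=
  forall D P1 Q1 : {poly {poly C}},
    P = D * P1 -> Q = D * Q1 -> exists2 c : C, c != 0 & D = c%:P%:P.

Definition preimages (P : {poly {poly C}}) (w : C) : set C :=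
  [set z | ev2 P z z^* = w]%classic.

Lemma ev2_polyanalytic m p z :
  ev2 (polyanalytic m p) z z^* = \sum_(k < m.+1) (p k).[z] * z^* ^+ k.
Proof.
rewrite /ev2 /polyanalytic !horner_sum; apply: eq_bigr => k _.
by rewrite hornerM hornerC hornerXn hornerM horner_exp hornerC.
Qed.

Lemma coef_conj_swap P i j : (conj_swap P)`_i`_j = (P`_j`_i)^*.
Proof. by rewrite /conj_swap coef_swapXY !coef_map. Qed.

Lemma ev2_conj_swap P z : ev2 (conj_swap P) z z^* = (ev2 P z z^*)^*.
Proof.
rewrite /ev2 /conj_swap horner2_swapXY -horner_map -horner_map.
by rewrite /= map_polyC /= conjCK.
Qed.

End Polyanalytic.

(* Main.v *)
Require Import Defs.
From HB Require Import structures.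
From mathcomp Require Import all_boot all_order all_algebra.
From mathcomp Require Import finmap complex.
From mathcomp Require Import boolp classical_sets functions cardinality reals.

Set Implicit Arguments.
Unset Strict Implicit.
Unset Printing Implicit Defensive.

Import Order.TTheory GRing.Theory Num.Theory.

Local Open Scope ring_scope.

(** Replace [conj z] by an independent variable: a preimage [z] of [w] gives the
    common zero [(z, conj z)] of [P = polyanalytic m p - w] and
    [Q = conj_swap P], and distinct preimages have distinct first coordinates.
    It therefore suffices to find one nonzero polynomial in the first variable,
    of degree at most [n ^ 2 + m ^ 2], that vanishes at the first coordinate of
    every common zero.  The resultant of [P] and [Q] with respect to the second
    variable is such a polynomial.

    - It vanishes there because it is a combination of the values of [P] and [Q]
      at any given value of the second variable ([resultant_comb_horner]).

    - Its degree is bounded row by row in the Sylvester matrix.  If [P] has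
      degree [n'] in the first variable and [m'] in the second, then [Q] has
      degrees [m'] and [n'], because conjugation exchanges the variables.  Hence
      [n'] rows have entries of degree at most [n'] and [m'] rows have entries of
      degree at most [m'], and the degree is at most [n' ^ 2 + m' ^ 2]
      ([size_resultant_leq]).  Working with the exact degrees [n' <= n] and
      [m' <= m] matters: with formal degrees both leading coefficients could
      vanish, and so would the determinant.

    - It is nonzero by coprimality.  A zero resultant gives a common factor only
      after multiplication by a polynomial in the first variable; this
      denominator is removed one root at a time, which is Gauss's lemma over an
      algebraically closed field ([clear_denominator]).

    The remaining case is a [P] that is constant in both variables, where the
    Sylvester matrix is empty; coprimality makes this constant nonzero, so that
    [w] has no preimage. *)

(** * Counting roots *)

(** The bound on the number of roots in a list applies to every finite part of
    [A], so it also excludes that [A] is infinite. *)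
Lemma card_le_roots (K : idomainType) (r : {poly K}) (A : set K) (N : nat) :
    r != 0 -> (size r <= N.+1)%N -> (forall z, A z -> root r z) ->
  (A #<= `I_N)%card.
Proof.
move=> r0 rN Ar.
have bound (X : {fset K}) : ([set` X] `<=` A)%classic -> (#|` X|%fset <= N)%N.
  move=> XA; rewrite -ltnS; apply: leq_trans rN.
  apply: max_poly_roots r0 _ (fset_uniq X).
  by apply/allP => z zX; apply/Ar/XA.
have finA : finite_set A.
  apply: contrapT => /(@infinite_set_fset _ _ N.+1)[X XA].
  by rewrite ltnNge bound.
have /finite_setP[k Ak] := finA.
rewrite (card_le_eql Ak) card_le_II -(card_fset_set Ak); apply: bound => z /=.
by rewrite in_fset_set // => /set_mem.
Qed.

(** * Vanishing and degree of the resultant *)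

(** The Sylvester matrix maps the column of powers of [y] to the column of all
    [y ^+ i * p.[y]] and [y ^+ i * q.[y]].  Multiplying by the adjugate and
    reading the first entry, where the power of [y] is 1, gives the combination;
    positivity of the matrix size provides this entry.  Unlike
    [resultant_in_ideal], this allows one of [p] and [q] to be constant. *)
Lemma resultant_comb_horner (R : comNzRingType) (p q : {poly R}) (y : R) :
    (0 < (size q).-1 + (size p).-1)%N ->
  exists u v : R, resultant p q = u * p.[y] + v * q.[y].
Proof.
set d := (_ + _)%N => d_gt0; pose j0 := Ordinal d_gt0 : 'I_d.
pose S := Sylvester_mx p q; pose Y : 'cV[R]_d := \col_j y ^+ j.
(* A block of rows acts as u |-> (u * r).[y] on coefficient vectors; both
   blocks are instances. *)
have rowE (r : {poly R}) (s : nat) (i : 'I_s) : ((size r).-1 + s <= d)%N ->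
    (lin1_mx (poly_rV \o r \o* rVpoly : 'rV_s -> 'rV_d) *m Y) i 0
      = y ^+ i * r.[y].
  move=> rd; rewrite !mxE.
  transitivity (\sum_(j < d) (r * 'X^i)`_j * y ^+ j).
    by apply: eq_bigr => j _; rewrite !mxE /= rVpoly_delta commr_polyXn.
  rewrite -horner_coef_wide; first by rewrite hornerM hornerXn mulrC.
  have [->|r0] := eqVneq r 0; first by rewrite mul0r size_poly0.
  rewrite size_mulXn //; apply: leq_trans rd.
  rewrite -[size r in leqLHS]prednK ?size_poly_gt0 // addnS.
  by rewrite [leqRHS]addnC ltn_add2r.
have SY i : (S *m Y) i 0 = match fintype.split i with
    inl k => y ^+ k * p.[y] | inr k => y ^+ k * q.[y] end.
  rewrite /S /Sylvester_mx mul_col_mx mxE.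
  case: (fintype.split i) => k; rewrite rowE //.
  by rewrite addnC.
have -> : resultant p q = (\adj S *m (S *m Y)) j0 0.
  by rewrite mulmxA mul_adj_mx mul_scalar_mx !mxE expr0 mulr1.
rewrite mxE big_split_ord /=.
exists (\sum_i \adj S j0 (lshift _ i) * y ^+ i),
       (\sum_i \adj S j0 (rshift _ i) * y ^+ i).
rewrite !mulr_suml; congr (_ + _); apply: eq_bigr => i _; rewrite SY.
  by rewrite (unsplitK (inl i)) mulrA.
by rewrite (unsplitK (inr i)) mulrA.
Qed.

(** The combination is taken over [{poly R}] at the constant [y], and only then
    evaluated at [x], so the leading coefficients of [p] and [q] may vanish at
    [x]. *)
Lemma root_resultant (R : comNzRingType) (p q : {poly {poly R}}) (x y : R) :
    (0 < (size q).-1 + (size p).-1)%N ->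
    p.[y%:P].[x] = 0 -> q.[y%:P].[x] = 0 -> root (resultant p q) x.
Proof.
move=> /resultant_comb_horner-/(_ y%:P)[u [v ->]] px qx.
by rewrite rootE !hornerE px qx !mulr0 addr0.
Qed.

Lemma size_det_leq (R : comNzRingType) (d : nat) (M : 'M[{poly R}]_d)
    (a : 'I_d -> nat) :
    (forall i j, (size (M i j) <= (a i).+1)%N) ->
  (size (\det M) <= (\sum_i a i).+1)%N.
Proof.
move=> Ma; apply: leq_trans (size_sum _ _ _) _; apply/bigmax_leqP => s _.
rewrite mulr_sign (fun_if (fun r : {poly R} => size r)) size_polyN if_same.
apply: leq_trans (size_poly_prod_leq _ _) _; rewrite leq_subLR.
apply: (@leq_trans (\sum_i (a i).+1).+1).
  by rewrite ltnS; apply: leq_sum => i _.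
rewrite addnS ltnS -sum1_card -big_split /=.
by apply: leq_sum => i _; rewrite add1n.
Qed.

(** [p] and [q] fill as many rows of the Sylvester matrix as the other has
    degree, which is why the degrees are paired crosswise. *)
Lemma size_resultant_leq (R : comNzRingType) (p q : {poly {poly R}}) :
  (size (resultant p q)
     <= ((size q).-1 * (sizeY p).-1 + (size p).-1 * (sizeY q).-1).+1)%N.
Proof.
pose a (i : 'I_((size q).-1 + (size p).-1)) :=
  if fintype.split i then (sizeY p).-1 else (sizeY q).-1.
apply: (@leq_trans (\sum_i a i).+1).
  apply: size_det_leq => i j; rewrite Sylvester_mxE /a.
  by case: (fintype.split i) => k; case: (k <= j)%N;
     rewrite ?mulr1n ?mulr0n ?size_poly0 //;
     apply: leq_trans (max_size_coefXY _ _) (leqSpred _).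
rewrite ltnS big_split_ord /= leq_eqVlt; apply/orP; left; apply/eqP.
rewrite /a; congr (_ + _)%N.
  under eq_bigr => i _ do rewrite (unsplitK (inl i)).
  by rewrite sum_nat_const card_ord.
under eq_bigr => i _ do rewrite (unsplitK (inr i)).
by rewrite sum_nat_const card_ord.
Qed.

(** * Common factors from a vanishing resultant *)

(** The factor theorem for the inner variable, transported from the outer one
    by exchanging the variables. *)
Lemma factor_coef_theorem (R : comNzRingType) (u : {poly {poly R}}) (a : R) :
    map_poly (horner_eval a) u = 0 ->
  exists v, u = ('X - a%:P) *: v.
Proof.
rewrite -horner_swapXY => /eqP/factor_theorem[v uv].
exists (swapXY v); rewrite -[LHS]swapXYK uv rmorphM rmorphB /=.
by rewrite swapXY_X swapXY_polyC map_polyC /= -polyCB mulrC mul_polyC.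
Qed.

(** By induction on the degree of [c].  At a root [a] of [c] the products
    [A * d] and [B * d] vanish when the inner variable is set to [a], and the
    polynomials in the outer variable form a domain: either [d] vanishes there,
    or both [A] and [B] do.  In both cases ['X - a] can be cancelled on each
    side, and dividing [d] by it does not change the degree of [d] in the outer
    variable. *)
Lemma clear_denominator (K : closedFieldType) (c : {poly K})
    (p q d A B : {poly {poly K}}) :
    c != 0 -> c *: p = A * d -> c *: q = B * d ->
  exists D P Q : {poly {poly K}},
    [/\ p = D * P, q = D * Q & size D = size d].
Proof.
have [k] := ubnP (size c); elim: k => // k IHk in c d A B * => ck c0 pA qB.
have [/eqP sc|sc] := boolP (size c == 1)%N.
  have [e e0 ce] := size_poly1P _ (introT eqP sc).
  have inv (r C : {poly {poly K}}) :
      c *: r = C * d -> r = d * (e^-1%:P *: C).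
    move=> rC; rewrite -scalerAr [d * C]mulrC -rC ce scalerA -polyCM.
    by rewrite mulVf // scale1r.
  by exists d, (e^-1%:P *: A), (e^-1%:P *: B); split=> //; apply: inv.
have [a /factor_theorem[c' cE]] := closed_rootP _ sc.
have X0 : 'X - a%:P != 0 :> {poly K} by rewrite polyXsubC_eq0.
have c'0 : c' != 0 by apply: contraNneq c0 => c'0; rewrite cE c'0 mul0r.
have c'k : (size c' < k)%N.
  by move: ck; rewrite cE size_Mmonic ?monicXsubC // size_XsubC addn2 ltnS.
have cancel (r s : {poly {poly K}}) :
    c *: r = ('X - a%:P) *: s -> c' *: r = s.
  rewrite cE mulrC -scalerA -!(mul_polyC ('X - _)).
  by apply: mulfI; rewrite polyC_eq0.
have ev (r C : {poly {poly K}}) : c *: r = C * d ->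
    map_poly (horner_eval a) C * map_poly (horner_eval a) d = 0.
  move=> rC; rewrite -rmorphM -rC /= map_polyZ /= {1}/horner_eval cE.
  by rewrite hornerM hornerXsubC subrr mulr0 scale0r.
have [/factor_coef_theorem[d' dE]|d_a] :=
    eqVneq (map_poly (horner_eval a) d) 0.
  have [D [P [Q [pD qD sD]]]] : exists D P Q : {poly {poly K}},
      [/\ p = D * P, q = D * Q & size D = size d'].
    by apply: (IHk c' d' A B) => //; apply: cancel;
       rewrite (pA, qB) dE scalerAr.
  by exists D, P, Q; rewrite pD qD sD dE size_scale.
have divs (r C : {poly {poly K}}) : c *: r = C * d ->
    exists C', c' *: r = C' * d.
  move=> rC; have /eqP := ev _ _ rC; rewrite mulf_eq0 (negbTE d_a) orbF.
  move=> /eqP/factor_coef_theorem[C' CE]; exists C'.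
  by apply: cancel; rewrite rC CE scalerAl.
have [A' pA'] := divs _ _ pA; have [B' qB'] := divs _ _ qB.
exact: IHk pA' qB'.
Qed.

(** The greatest common divisor over the domain [{poly K}] divides [p] and [q]
    only up to scalars in [{poly K}], here [a] and [b]; their product is the
    common denominator to be cleared. *)
Lemma resultant_eq0_common_factor (K : closedFieldType)
    (p q : {poly {poly K}}) : resultant p q = 0 ->
  exists D P Q : {poly {poly K}},
    [/\ p = D * P, q = D * Q & (1 < size D)%N].
Proof.
move=> /eqP; rewrite resultant_eq0; set d := Pdiv.Idomain.gcdp p q => sd.
have /Pdiv.Idomain.dvdpP[[a A] /= a0 pA] := Pdiv.Idomain.dvdp_gcdl p q.
have /Pdiv.Idomain.dvdpP[[b B] /= b0 qB] := Pdiv.Idomain.dvdp_gcdr p q.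
have [| | |D [P [Q [pD qD sD]]]] :=
    @clear_denominator K (b * a) p q d (b *: A) (a *: B).
- by rewrite mulf_neq0.
- by rewrite -scalerA pA scalerAl.
- by rewrite mulrC -scalerA qB scalerAl.
by exists D, P, Q; rewrite sD.
Qed.

(** * Degrees under conjugation, and coprimality *)

Section ConjSwap.
Variable R : realType.
Implicit Type P : {poly {poly R[i]}}.

Lemma size_map_conj2 P : size (map_poly (map_poly Num.conj) P) = size P.
Proof.
apply: size_map_inj_poly; last by rewrite rmorph0.
by apply: map_inj_poly; [exact: (inv_inj (@conjCK _)) | rewrite rmorph0].
Qed.

Lemma sizeY_conj_swap P : sizeY (conj_swap P) = size P.
Proof. by rewrite sizeYE /conj_swap swapXYK size_map_conj2. Qed.

Lemma size_conj_swap P : size (conj_swap P) = sizeY P.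
Proof. by rewrite /conj_swap swapXY_map size_map_conj2 -sizeYE. Qed.

Lemma coprime2_neq0 P : coprime2 P (conj_swap P) -> P != 0.
Proof.
move=> cop; apply/eqP => P0.
have [||c c0 /esym/eqP] := cop 0 0 0; rewrite ?P0 ?mul0r //.
  by rewrite /conj_swap !rmorph0.
by rewrite !polyC_eq0 (negbTE c0).
Qed.

Lemma coprime2_resultant_neq0 P Q : coprime2 P Q -> resultant P Q != 0.
Proof.
move=> cop; apply/eqP => /resultant_eq0_common_factor[D [P1 [Q1 [PD QD sD]]]].
have [c _ Dc] := cop _ _ _ PD QD.
by move: sD; rewrite Dc size_polyC; case: (_ != 0).
Qed.

Lemma size_polyanalytic_sub m n (p : nat -> {poly R[i]}) w :
    (forall k, (k <= m)%N -> (size (p k) <= n.+1)%N) ->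
  let P := polyanalytic m p - w%:P%:P in
  (size P <= m.+1)%N /\ (sizeY P <= n.+1)%N.
Proof.
move=> deg_p P.
have pE : polyanalytic m p = \poly_(k < m.+1) p k.
  by rewrite poly_def; apply: eq_bigr => k _; rewrite mul_polyC.
have sP : (size P <= m.+1)%N.
  apply: leq_trans (size_polyD _ _) _; rewrite size_polyN geq_max pE size_poly.
  by apply: leq_trans (size_polyC_leq1 _) _.
split=> //; apply/bigmax_leqP => k _.
rewrite coefB coefC pE coef_poly ltnS.
apply: leq_trans (size_polyD _ _) _; rewrite size_polyN geq_max.
apply/andP; split.
  by case: (leqP k m) => [/deg_p|_] //; rewrite size_poly0.
case: eqP => _; last by rewrite size_poly0.
by apply: leq_trans (size_polyC_leq1 _) _.
Qed.

End ConjSwap.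

(* The prescribed value w is absorbed in the constant term of P, and coprimality
   is required of P - w and its conjugate; w = 0 is coprimality of P and Q.
   Coprimality of P and Q does not bound the preimages of every w:
   P = z * conj z + 'i and Q = z * conj z - 'i are coprime, while P takes the
   value 1 + 'i on the whole unit circle. *)
Theorem proposition1p10 (R : realType) (m n : nat) (p : nat -> {poly R[i]})
    (w : R[i])
    (deg_p : forall k : nat, (k <= m)%N -> (size (p k) <= n.+1)%N)
    (coprimePQ : coprime2 (polyanalytic m p - w%:P%:P)
                          (conj_swap (polyanalytic m p - w%:P%:P))) :
  (preimages (polyanalytic m p) w #<= `I_(n ^ 2 + m ^ 2)%N)%card.
Proof.
set P := _ - _ in coprimePQ; pose Q := conj_swap P.
have [sP sYP] : ((size P).-1 <= m)%N /\ ((sizeY P).-1 <= n)%N.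
  have [sP sYP] := size_polyanalytic_sub w deg_p.
  by rewrite -!subn1 !leq_subLR.
apply: (@card_le_roots _ (resultant P Q)).
- exact: coprime2_resultant_neq0.
- apply: leq_trans (size_resultant_leq _ _) _.
  rewrite ltnS size_conj_swap sizeY_conj_swap -!mulnn -/P.
  exact: leq_add (leq_mul sYP sYP) (leq_mul sP sP).
move=> z /= Pz.
have Pz0 : ev2 P z z^* = 0.
  by move: Pz; rewrite /preimages /= /P /ev2 !hornerE => ->; rewrite subrr.
have Qz0 : ev2 Q z z^* = 0 by rewrite ev2_conj_swap Pz0 rmorph0.
(* An empty Sylvester matrix has determinant 1, which says nothing about the
   common zeros. *)
have [d0|d_gt0] := posnP ((size Q).-1 + (size P).-1)%N; last first.
  exact: root_resultant d_gt0 Pz0 Qz0.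
have := coprime2_neq0 coprimePQ.
move: d0; rewrite size_conj_swap => /eqP; rewrite addn_eq0 => /andP[sY0 s0].
have PE : P = (P`_0)%:P by apply: size1_polyC; rewrite -subn_eq0 subn1.
have P0E : P`_0 = (P`_0`_0)%:P.
  apply: size1_polyC; apply: leq_trans (max_size_coefXY P 0) _.
  by rewrite -subn_eq0 subn1.
move: Pz0; rewrite /ev2 PE hornerC P0E hornerC => ->.
by rewrite eqxx.
Qed.
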